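(* Let $\zeta=\{\zeta_n(r)\}_{n=0}^{\infty}\in\mathcal F$, let $p\in\mathbb N$ ($p\ge1$), let $m$ be an integer with $0\le m\le p$, and let $f\in\mathcal B$ with $f(z)=\sum_{n=0}^{\infty}a_{pn+m}z^{pn+m}$. Then $$\sum_{n=1}^{\infty}|a_{np+m}|\zeta_{n}(r^p)+\sum_{n=1}^{\infty}|a_{np+m}|^2\Big(\frac{\zeta_{2n}(r^p)}{1+|a_m|}+\sum_{k=2n+1}^{\infty}\zeta_{k}(r^p)\Big)\le(1-|a_m|^2)\sum_{n=1}^{\infty}\zeta_{n}(r^p)$$ holds for $r\in[0,1)$. The result is sharp: equality holds for $f(z)=z^m\frac{a-z^p}{1-az^p}$ with $a\in[0,1)$.
   Context: $\mathbb D=\{z\in\mathbb C:|z|<1\}$. $\mathcal B$ is the class of analytic functions $f$ on $\mathbb D$ with $|f(z)|<1$ for all $z\in\mathbb D$. $\mathcal F$ is the set of all sequences $\{\zeta_n(r)\}_{n=0}^\infty$ of nonnegative continuous functions on $[0,1)$ such that $\sum_{n=0}^\infty\zeta_n(r)$ converges locally uniformly with respect to $r\in[0,1)$. *)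

(* Defs.v *)
(* MathComp world (MathComp-Analysis). *)
From mathcomp Require Import all_boot all_order all_algebra.
From mathcomp Require Import all_classical all_reals all_analysis.
From mathcomp Require Export complex.

Set Implicit Arguments.
Unset Strict Implicit.
Unset Printing Implicit Defensive.

Import Order.TTheory GRing.Theory Num.Theory.
Import numFieldNormedType.Exports.

Local Open Scope classical_set_scope.
Local Open Scope complex_scope.
Local Open Scope ring_scope.

(* The real modulus: [`|z|] lives in R[i] and equals [(cmod z)%:C]. *)
Notation cmod := Normc.normc.

(* Complex numbers are typed R[i]^o because that is where the library puts the
   normed R[i]-module structure; hence [derivable f z 1] is differentiability
   with complex increments.  Values of f off the unit disc are irrelevant. *)
Definition classB (R : realType) (f : R[i]^o -> R[i]^o) : Prop :=
  forall z : R[i]^o, `|z| < 1 -> derivable f z 1 /\ `|f z| < 1.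

Definition locally_uniformly_summable (R : realType) (D : set R)
    (zeta : nat -> R -> R) : Prop :=
  exists s : R -> R, forall x, D x -> exists2 U : set R, nbhs x U &
    {uniform U `&` D,
      (fun (N : nat) (t : R) => \sum_(0 <= n < N) zeta n t) @ \oo --> s}.

Definition classF (R : realType) (zeta : nat -> R -> R) : Prop :=
  [/\ forall (n : nat) (x : R), 0 <= x < 1 -> 0 <= zeta n x,
      forall n, {within `[0, 1[, continuous (zeta n)} &
      locally_uniformly_summable `[0, 1[ zeta].

(* Only the coefficients a_(p n + m) are used. *)
Definition has_expansion (R : realType) (p m : nat) (a : nat -> R[i]^o)
    (f : R[i]^o -> R[i]^o) : Prop :=
  forall z : R[i]^o, `|z| < 1 ->
    (fun N : nat => \sum_(0 <= n < N) a (p * n + m)%N * z ^+ (p * n + m))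
      @ \oo --> f z.

(* All the series below have nonnegative terms (for zeta in classF and
   0 <= r < 1), so they are summed in the extended reals; an inequality with a
   finite right-hand side thus includes convergence of the left-hand side. *)
Definition refined_bohr_sum (R : realType) (zeta : nat -> R -> R) (p m : nat)
    (a : nat -> R[i]^o) (r : R) : \bar R :=
  (\sum_(1 <= n <oo) (cmod (a (n * p + m)%N) * zeta n (r ^+ p))%:E
   + \sum_(1 <= n <oo) ((cmod (a (n * p + m)%N) ^+ 2)%:E *
       ((zeta (2 * n)%N (r ^+ p) / (1 + cmod (a m)))%:E
        + \sum_((2 * n + 1)%N <= k <oo) (zeta k (r ^+ p))%:E)))%E.

Definition bohr_bound (R : realType) (zeta : nat -> R -> R) (p m : nat)
    (a : nat -> R[i]^o) (r : R) : \bar R :=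
  ((1 - cmod (a m) ^+ 2)%:E * \sum_(1 <= n <oo) (zeta n (r ^+ p))%:E)%E.

Definition extremal (R : realType) (p m : nat) (t : R) :
    R[i]^o -> R[i]^o :=
  fun z => z ^+ m * ((t%:C - z ^+ p) / (1 - t%:C * z ^+ p)).

(* Main.v *)
Require Import Defs.
From mathcomp Require Import all_boot all_order all_algebra.
From mathcomp Require Import all_classical all_reals all_analysis.
From mathcomp Require Import cyclic separable cyclotomic.
From mathcomp Require Import ring lra zify.

(* Write [f z = z^m g(z^p)] with [g w = sum_n b_n w^n].  Since [m <= p],
   [|g w| <= 1 / |w|] for [0 < |w| < 1].  Parseval's identity on circles of
   radius [r] (discretized at roots of unity, with [r -> 1]) then shows that the
   lower triangular Toeplitz matrices of [b] are contractions.  Applying these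
   to suitable vectors gives Carlson's inequalities
     [|b_(2n+1)| <= 1 - |b_0|^2 - ... - |b_n|^2],
     [|b_(2n)| <= 1 - |b_0|^2 - ... - |b_(n-1)|^2 - |b_n|^2 / (1 + |b_0|)],
   and once the double series is rearranged these are exactly the comparison of
   the coefficients of [zeta_(2n+1)] and [zeta_(2n)] on both sides.  For the
   extremal function Carlson's inequalities are equalities. *)

Set Implicit Arguments.
Unset Strict Implicit.
Unset Printing Implicit Defensive.

Import Order.TTheory GRing.Theory Num.Theory.
Import numFieldNormedType.Exports.

Local Open Scope ring_scope.

(** * Roots of unity and the discrete Parseval identity *)

Lemma closed_prim_root_exists (C : numClosedFieldType) (n : nat) :
  (0 < n)%N -> exists z : C, n.-primitive_root z.
Proof.
move=> n_gt0; pose p : {poly C} := 'X^n - 1.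
have [rs def_p] := closed_field_poly_normal p.
have mon_p : p \is monic by rewrite monicXnsubC.
rewrite (monicP mon_p) scale1r in def_p.
have sz_rs : size rs = n.
  by apply: succn_inj; rewrite -(size_prod_XsubC rs id) -def_p size_XnsubC.
have rs_unity : all n.-unity_root rs.
  by apply/allP=> z; rewrite unity_rootE -root_prod_XsubC -def_p /root !hornerE subr_eq0.
have uniq_rs : uniq rs.
  rewrite -separable_prod_XsubC -def_p.
  by rewrite /p separable_Xn_sub_1 // pnatr_eq0 -lt0n.
by have /hasP[z _ prim_z] :=
  has_prim_root n_gt0 rs_unity uniq_rs (eq_leq (esym sz_rs)); exists z.
Qed.

(** Conjugation inverts a root of unity, so this is a geometric sum of ratio [x = z ^+ k / z ^+ l].
    If [k] and [l] differ, [x ^+ n = 1] and [x != 1] force it to vanish. *)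
Lemma prim_root_orthogonality (C : numClosedFieldType) (n : nat) (z : C) (k l : nat) :
  n.-primitive_root z -> (k < n)%N -> (l < n)%N ->
  \sum_(i < n) z ^+ (i * k) * (z ^+ (i * l))^* = (n * (k == l))%:R.
Proof.
move=> pz kn ln.
have nz : `|z| = 1.
  apply/eqP; rewrite -(@pexpr_eq1 _ _ n) ?(prim_order_gt0 pz) //.
  by rewrite -normrX prim_expr_order ?normr1.
have z0 : z != 0 by rewrite -normr_eq0 nz oner_eq0.
have zV j : (z ^+ j)^* = z ^- j.
  by rewrite invC_norm normrX nz !expr1n invr1 mul1r.
pose x := z ^+ k / z ^+ l.
under eq_bigr => i _.
  rewrite zV mulnC [(i * l)%N]mulnC !exprM -expr_div_n -/x; over.
case: (eqVneq k l) => [kl|kl]; last first.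
  have x1 : x != 1.
    rewrite -subr_eq0 /x -(inj_eq (mulIf (expf_neq0 l z0))) mul0r mulrBl mul1r.
    by rewrite divfK ?expf_neq0 // subr_eq0 (eq_prim_root_expr pz) !modn_small.
  rewrite muln0; apply: (mulfI (_ : x - 1 != 0)); first by rewrite subr_eq0.
  rewrite -subrX1 mulr0 /x expr_div_n -!exprM.
  rewrite ![(_ * n)%N]mulnC !exprM (prim_expr_order pz).
  by rewrite !expr1n divr1 subrr.
under eq_bigr => i _ do rewrite /x kl divff ?expf_neq0 // expr1n.
by rewrite sumr_const card_ord muln1.
Qed.

Lemma parseval_prim_root (C : numClosedFieldType) (n : nat) (z : C) (q : nat -> C) :
  n.-primitive_root z ->
  \sum_(i < n) `|\sum_(k < n) q k * z ^+ (i * k)| ^+ 2 =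
  n%:R * \sum_(k < n) `|q k| ^+ 2.
Proof.
move=> pz.
under eq_bigr => i _.
  rewrite normCK rmorph_sum big_distrlr /=.
  under eq_bigr => k _ do under eq_bigr => l _ do rewrite rmorphM mulrACA.
  over.
rewrite exchange_big mulr_sumr /=; apply: eq_bigr => k _.
rewrite exchange_big (bigD1 k) //= -mulr_sumr prim_root_orthogonality // eqxx muln1.
rewrite big1 ?addr0 => [|l lk]; first by rewrite -normCK mulrC.
rewrite -mulr_sumr prim_root_orthogonality //.
by rewrite eq_sym -val_eqE in lk; rewrite (negPf lk) muln0 mulr0.
Qed.

Local Open Scope complex_scope.

(** * The real-valued modulus, and Parseval on circles *)

Section Cmod.
Variable R : realType.
Implicit Types (x y z : R[i]) (r s : R).

Lemma normcE_cmod z : `|z| = (cmod z)%:C.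
Proof. by []. Qed.

Lemma cmod_ge0 z : 0 <= cmod z.
Proof. by case: z => a b; exact: sqrtr_ge0. Qed.

Lemma cmod_sqr z : cmod z ^+ 2 = complex.Re z ^+ 2 + complex.Im z ^+ 2.
Proof. by case: z => a b; rewrite sqr_sqrtr // addr_ge0 // sqr_ge0. Qed.

Lemma cmod_real r : cmod r%:C = `|r|.
Proof. by rewrite /= expr0n addr0 sqrtr_sqr. Qed.

Lemma cmodX z n : cmod (z ^+ n) = cmod z ^+ n.
Proof.
elim: n => [|n IH]; first by rewrite !expr0 Normc.normc1.
by rewrite !exprS Normc.normcM IH.
Qed.

Lemma cmod_sum I (s : seq I) (P : pred I) (F : I -> R[i]) :
  cmod (\sum_(i <- s | P i) F i) <= \sum_(i <- s | P i) cmod (F i).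
Proof.
elim/big_ind2: _ => [|x a y b xa yb|i _]; rewrite ?Normc.normc0 //.
by apply: le_trans (le_normcD _ _) (lerD xa yb).
Qed.

End Cmod.

Lemma cvg_cmodP (R : realType) (u : nat -> R[i]^o) (l : R[i]^o) :
  (u @ \oo --> l)%classic <->
  forall e : R, 0 < e -> exists N, forall n, (N <= n)%N -> cmod (u n - l) < e.
Proof.
split=> [/cvgrPdist_lt ul e e0|H].
  have /ul : 0 < e%:C by rewrite ltcR.
  case=> N _ HN; exists N => n Nn.
  by move: (HN n Nn); rewrite /= distrC normcE_cmod ltcR.
apply/cvgrPdist_lt => e e0.
(* Positivity in [R[i]] forces a zero imaginary part, so a complex epsilon is a real one. *)
have eR : e = (complex.Re e)%:C by case: e e0 => a b; rewrite ltcE /= => /andP[/eqP -> _].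
have /H[N HN] : 0 < complex.Re e by rewrite -ltcR -eR.
by exists N => // n /= Nn; rewrite distrC normcE_cmod eR ltcR; exact: HN.
Qed.

(** As [size q <= n], no two frequencies alias, and sampling [n] points of the circle of radius
    [cmod x] is exact. *)
Lemma parseval_horner (R : realType) (n : nat) (z x : R[i]) (q : {poly R[i]}) :
  n.-primitive_root z -> (size q <= n)%N ->
  \sum_(i < n) cmod q.[x * z ^+ i] ^+ 2 =
  n%:R * \sum_(k < n) cmod q`_k ^+ 2 * cmod x ^+ (2 * k).
Proof.
move=> pz qn; apply: complexI.
rewrite rmorphM rmorph_nat !rmorph_sum /=.
have := parseval_prim_root (fun k => q`_k * x ^+ k) pz.
congr (_ = _); first apply: eq_bigr => i _.
  rewrite rmorphXn /= -normcE_cmod; congr (_ ^+ 2); rewrite (horner_coef_wide _ qn).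
  by congr `|_|; apply: eq_bigr => k _; rewrite exprMn mulrA exprM.
congr (_ * _); apply: eq_bigr => k _.
by rewrite rmorphM !rmorphXn /= -!normcE_cmod normrM exprMn normrX -exprM mulnC.
Qed.

(** * Uniform bounds for partial sums on circles *)

Lemma sum_geometric_le (R : realFieldType) (q : R) (K n : nat) :
  0 <= q < 1 -> \sum_(K <= i < n) q ^+ i <= q ^+ K / (1 - q).
Proof.
move=> /andP[q0 q1]; have d0 : 0 < 1 - q by rewrite subr_gt0.
rewrite ler_pdivlMr // mulr_suml.
have [nK|Kn] := leqP n K.
  by rewrite big_geq // exprn_ge0.
under eq_bigr => i _ do rewrite mulrBr mulr1 -exprSr -opprB.
by rewrite sumrN telescope_sumr 1?ltnW // opprB lerBlDr lerDl exprn_ge0 //.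
Qed.

(** The limit is asked for pointwise, so no function [g] has to be built. The bound [1 / |w|] serves
    all [m <= p] at once and tends to 1 at the unit circle. *)
Definition power_series_le_inv (R : realType) (b : nat -> R[i]^o) : Prop :=
  forall w : R[i]^o, w != 0 -> cmod w < 1 ->
    exists2 l : R[i]^o, cmod l <= (cmod w)^-1 &
      ((fun n => \sum_(0 <= k < n) b k * w ^+ k) @ \oo --> l)%classic.

(** Convergence at one real point [rho > r] bounds [|b_k| rho^k]. On the circle of radius [r] the
    tails are then dominated by a geometric series of ratio [r / rho], which gives a [K] independent
    of [w]. *)
Lemma partial_sums_uniform_bound (R : realType) (b : nat -> R[i]^o) (r e : R) (N : nat) :
  power_series_le_inv b ->
  0 < r < 1 -> 0 < e ->
  exists2 K, (N <= K)%N &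
    forall w : R[i], cmod w = r -> cmod (\sum_(0 <= k < K) b k * w ^+ k) <= r^-1 + e.
Proof.
move=> hb /andP[r0 r1] e0.
pose rho := (r + 1) / 2; have rrho : r < rho by rewrite /rho; lra.
have rho0 : 0 < rho by rewrite /rho; lra.
have rho1 : rho < 1 by rewrite /rho; lra.
have crho : cmod rho%:C = rho by rewrite cmod_real gtr0_norm.
have [||l _ /cvg_cmodP/(_ 1 ltr01)[N1 HN1]] := hb rho%:C.
- by rewrite fmorph_eq0 gt_eqF.
- by rewrite crho.
(* A term is the difference of two consecutive partial sums, both within 1 of the limit. *)
have bterm k : (N1 <= k)%N -> cmod (b k) * rho ^+ k <= 2.
  move=> Nk.
  have -> : cmod (b k) * rho ^+ k = cmod (b k * rho%:C ^+ k).
    by rewrite Normc.normcM cmodX crho.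
  have := HN1 k.+1 (leqW Nk); have := HN1 k Nk.
  rewrite big_nat_recr //=; set S := \sum_(0 <= _ < k) _; set t := b k * _ => h1 h2.
  have -> : t = (S + t - l) + - (S - l) by ring.
  have := le_normcD (S + t - l) (- (S - l)); rewrite normcN.
  by move: h1 h2; lra.
pose q := r / rho.
have q01 : 0 <= q < 1.
  by rewrite /q divr_ge0 ?ltW //= ltr_pdivrMr // mul1r.
have /andP[q0 q1] := q01.
have d0 : 0 < 1 - q by rewrite subr_gt0.
have [N2 HN2] : exists N2, forall k, (N2 <= k)%N -> 2 * (q ^+ k / (1 - q)) < e / 2.
  have /cvgrPdist_lt : ((fun k => q ^+ k) @ \oo --> (0 : R))%classic.
    by apply: cvg_expr; rewrite ger0_norm.
  have e2 : 0 < e * (1 - q) / 4 by rewrite divr_gt0 // mulr_gt0.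
  move=> /(_ _ e2)[N2 _ HN2]; exists N2 => k /HN2 /=.
  rewrite sub0r normrN ger0_norm ?exprn_ge0 // => h.
  rewrite mulrA ltr_pdivrMr //; move: h; lra.
pose K := maxn N (maxn N1 N2).
exists K; first exact: leq_maxl.
move=> w wr.
have KN1 : (N1 <= K)%N by rewrite /K; lia.
have KN2 : (N2 <= K)%N by rewrite /K; lia.
have e20 : 0 < e / 2 by rewrite divr_gt0.
have [||l' hl' /cvg_cmodP/(_ _ e20)[N3 HN3]] := hb w.
- by apply: contraTN r0 => /eqP w0; rewrite -wr w0 Normc.normc0 ltxx.
- by rewrite wr.
(* [N3] depends on [w], but [K'] is only auxiliary: the sum up to [K'] is [e / 2]-close to the
   limit, and the block from [K] to [K'] costs at most another [e / 2]. *)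
pose K' := maxn K N3.
have := HN3 K' (leq_maxr _ _).
rewrite (big_cat_nat _ (n := K)) //= ?leq_maxl //.
set S := \sum_(0 <= _ < _) _; set T := \sum_(_ <= _ < _) _ => h.
have hT : cmod T <= 2 * (q ^+ K / (1 - q)).
  apply: le_trans (cmod_sum _ _ _) _.
  apply: (@le_trans _ _ (\sum_(K <= k < K') 2 * q ^+ k)); last first.
    by rewrite -mulr_sumr ler_pM2l //; exact: sum_geometric_le.
  apply: ler_sum_nat => k /andP[Kk _].
  rewrite Normc.normcM cmodX wr /q expr_div_n mulrA.
  rewrite ler_pdivlMr ?exprn_gt0 // mulrAC ler_pM2r ?exprn_gt0 //.
  by apply: bterm; exact: leq_trans Kk.
have -> : S = (S + T - l') + (- T + l') by ring.
have := le_normcD (S + T - l') (- T + l'); have := le_normcD (- T) l'.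
rewrite normcN; have := HN2 K KN2; rewrite wr in hl'.
by move: h hT hl'; lra.
Qed.

(** * Contractivity of Toeplitz matrices *)

Definition toeplitz_contractive (R : realType) (b : nat -> R[i]) : Prop :=
  forall (c : nat -> R[i]) (N : nat),
    \sum_(0 <= k < N) cmod (\sum_(0 <= j < k.+1) c j * b (k - j)%N) ^+ 2 <=
    \sum_(0 <= k < N) cmod (c k) ^+ 2.

(** The Toeplitz matrix acts as multiplication of generating series. On [|w| = r], a partial sum [P]
    of the series of [b] has modulus at most [r^-1 + e], so Parseval compares the coefficients of
    [Q * P] with those of [Q]. Then [e] tends to 0 and [r] to 1. *)
Lemma toeplitz_contraction (R : realType) (b : nat -> R[i]^o) :
  power_series_le_inv b -> toeplitz_contractive b.
Proof.
move=> hb c N; rewrite !big_mkord.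
set A := \sum_(k < N) _; set B := \sum_(k < N) _.
have A0 : 0 <= A by apply: sumr_ge0 => k _; rewrite sqr_ge0.
have B0 : 0 <= B by apply: sumr_ge0 => k _; rewrite sqr_ge0.
have key r e : 0 < r < 1 -> 0 < e -> A * r ^+ (2 * N) <= (r^-1 + e) ^+ 2 * B.
  move=> r01 e0; have /andP[r0 r1] := r01.
  have [K NK hK] := partial_sums_uniform_bound N hb r01 e0.
  pose P : {poly R[i]} := \poly_(k < K) b k.
  pose Q : {poly R[i]} := \poly_(k < N) c k.
  have sP : (size P <= K)%N by exact: size_poly.
  have sQ : (size Q <= N)%N by exact: size_poly.
  (* Large enough for Parseval to be exact on both [Q] and [Q * P]. *)
  pose n := (K + N).+1.
  have sQn : (size Q <= n)%N by rewrite /n; lia.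
  have sQP : (size (Q * P)%R <= n)%N.
    by apply: leq_trans (size_polyMleq _ _) _; rewrite /n; lia.
  have [z pz] := @closed_prim_root_exists R[i] n isT.
  have cz i : cmod (r%:C * z ^+ i) = r.
    have nz : cmod z = 1.
      apply/eqP; rewrite -(@pexpr_eq1 _ _ n) ?cmod_ge0 //.
      by rewrite -cmodX (prim_expr_order pz) Normc.normc1.
    by rewrite Normc.normcM cmodX nz expr1n mulr1 cmod_real gtr0_norm.
  have e1 := parseval_horner r%:C pz sQP; have e2 := parseval_horner r%:C pz sQn.
  have n0 : 0 < n%:R :> R by rewrite ltr0n.
  have : n%:R * (A * r ^+ (2 * N)) <= n%:R * ((r^-1 + e) ^+ 2 * B).
    apply: (@le_trans _ _ (\sum_(i < n) cmod (Q * P).[r%:C * z ^+ i] ^+ 2)).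
      rewrite e1 ler_pM2l // cmod_real gtr0_norm //.
      have Nn : (N <= n)%N by rewrite /n; lia.
      rewrite (big_ord_widen n (fun k : nat =>
        cmod (\sum_(0 <= j < k.+1) c j * b (k - j)%N) ^+ 2) Nn) in A A0 *.
      rewrite /A mulr_suml big_mkcond /=; apply: ler_sum => k _.
      case: ifP => [kN|_]; last by rewrite mulr_ge0 ?sqr_ge0 ?exprn_ge0 ?ltW.
      rewrite coefM.
      (* Since [k < N <= K], truncating the two series does not affect this coefficient. *)
      have -> : \sum_(j < k.+1) Q`_j * P`_(k - j) =
          \sum_(0 <= j < k.+1) c j * b (k - j)%N.
        rewrite big_mkord; apply: eq_bigr => j _; rewrite !coef_poly.
        by rewrite (leq_ltn_trans _ (leq_trans kN NK)) ?leq_subr //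
          (leq_trans (ltn_ord j) kN).
      by rewrite ler_wpM2l ?sqr_ge0 // ler_wiXn2l ?ltW //; lia.
    apply: (@le_trans _ _ (\sum_(i < n) (r^-1 + e) ^+ 2 * cmod Q.[r%:C * z ^+ i] ^+ 2)).
      apply: ler_sum => i _; rewrite hornerM Normc.normcM exprMn mulrC.
      rewrite ler_wpM2r ?sqr_ge0 // lerXn2r ?nnegrE ?cmod_ge0 //.
        by rewrite addr_ge0 ?invr_ge0 ?ltW.
      rewrite horner_poly -(big_mkord xpredT (fun k => b k * _ ^+ k)).
      by apply: hK; exact: cz.
    rewrite -mulr_sumr e2 mulrCA ler_pM2l // ler_wpM2l ?sqr_ge0 //.
    have Nn : (N <= n)%N by rewrite /n; lia.
    rewrite /B (big_ord_widen n (fun k : nat => cmod (c k) ^+ 2) Nn) [leRHS]big_mkcond.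
    apply: ler_sum => k _; rewrite coef_poly; case: ifP => _.
      rewrite ler_piMr ?sqr_ge0 // cmod_real gtr0_norm //.
      by rewrite exprn_ile1 // ltW.
    by rewrite Normc.normc0 expr0n /= mul0r.
  by rewrite ler_pM2l.
have key2 r : 0 < r < 1 -> A * r ^+ (2 * N + 2) <= B.
  move=> /andP[r0 r1].
  (* Taking [e / r] for the error, the extra factor [r ^+ 2] turns [(r^-1 + e / r) ^+ 2] into
     [(1 + e) ^+ 2]. *)
  have {key}key e : 0 < e -> A * r ^+ (2 * N + 2) <= (1 + e) ^+ 2 * B.
    move=> e0; have er : 0 < e / r by rewrite divr_gt0.
    have r01 : 0 < r < 1 by rewrite r0.
    have /(ler_wpM2r (sqr_ge0 r)) := key r (e / r) r01 er.
    rewrite -mulrA -exprD => h; apply: le_trans h _.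
    by rewrite mulrAC -exprMn mulrDl mulVf ?gt_eqF // divfK ?gt_eqF.
  rewrite leNgt; apply/negP => lt.
  set X := A * _ in key lt.
  have : forall e, 0 < e < 1 -> X <= B + 3 * e * B.
    move=> e /andP[e0 e1]; apply: le_trans (key e e0) _.
    have : 0 <= B * (e * (1 - e)) by rewrite !mulr_ge0 // ?subr_ge0 ltW.
    nra.
  move=> {}key.
  (* Chosen so that [e < 1] and [3 * e * B < X - B], against the previous bound. *)
  pose e := (X - B) / (X - B + 4 * B + 1).
  have d0 : 0 < X - B + 4 * B + 1 by lra.
  have /key : 0 < e < 1.
    by rewrite /e divr_gt0 ?subr_gt0 //= ltr_pdivrMr //; lra.
  have : e * (X - B + 4 * B + 1) = X - B by rewrite /e divfK ?gt_eqF.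
  have : 0 < e by rewrite /e divr_gt0 ?subr_gt0.
  set D := X - B; have D0 : 0 < D by rewrite subr_gt0.
  have -> : X = B + D by rewrite /D; ring.
  nra.
rewrite leNgt; apply/negP => lt.
pose M := (2 * N + 2)%N.
(* With Bernoulli's inequality, [r = 1 - s] gives [A - B <= M * s * A], whereas this [s] makes
   [M * s * A] less than [A - B]. *)
pose s := (A - B) / (2 * (M%:R * A + A)).
have M0 : 0 <= M%:R * A by rewrite mulr_ge0.
have Ap : 0 < A by apply: le_lt_trans lt.
have s0 : 0 < s by rewrite divr_gt0 ?subr_gt0 //; lra.
have s1 : s < 1 by rewrite ltr_pdivrMr; lra.
have /key2 : 0 < 1 - s < 1 by lra.
have bern : 1 - M%:R * s <= (1 - s) ^+ M.
  elim: (M) => [|k IH]; first by rewrite mul0r subr0 expr0.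
  have s1' : 0 <= 1 - s by lra.
  rewrite exprS; apply: le_trans _ (ler_wpM2l s1' IH).
  rewrite -natr1; have : 0 <= k%:R * s ^+ 2 :> R by rewrite mulr_ge0 ?sqr_ge0.
  nra.
have /(ler_wpM2l (ltW Ap)) := bern.
have : s * (2 * (M%:R * A + A)) = A - B by rewrite /s divfK ?gt_eqF //; lra.
have : 0 < s * A by rewrite mulr_gt0.
rewrite -/M; nra.
Qed.

(** * Test vectors for the Toeplitz contraction *)

Lemma sum_indicator (A : pzRingType) (m a : nat) (F : nat -> A) :
  \sum_(0 <= j < m) (j == a)%:R * F j = (a < m)%:R * F a.
Proof.
rewrite (eq_bigr (fun j => if j == a then F j else 0)) => [|j _].
  by rewrite -big_mkcond /= big_nat1_eq; case: (a < m)%N; rewrite ?mul1r ?mul0r.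
by case: eqP; rewrite ?mul1r ?mul0r.
Qed.

Lemma mul_conjc (R : realType) (z : R[i]) : z^* * z = (cmod z ^+ 2)%:C.
Proof. by rewrite mulrC -normCK rmorphXn. Qed.

(* The vector is [c_j = u [j = 0] + e [j = n] + tau [n < j] conj b_(L-j)]; only
   the rows [0, ..., n] and [L] of the Toeplitz matrix are kept. *)
Lemma toeplitz_test_vector (R : realType) (b : nat -> R[i]) (n L : nat)
    (u e tau : R[i]) (S : R) :
  toeplitz_contractive b ->
  (n < L)%N -> (0 < n)%N || (e == 0) ->
  S = \sum_(0 <= k < L - n) cmod (b k) ^+ 2 ->
  \sum_(0 <= k < n) cmod (u * b k) ^+ 2 + cmod (u * b n + e * b 0%N) ^+ 2
    + cmod (u * b L + e * b (L - n)%N + tau * S%:C) ^+ 2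
  <= cmod u ^+ 2 + cmod e ^+ 2 + cmod tau ^+ 2 * S.
Proof.
move=> contr nL n_e SE0.
pose c j : R[i] :=
  (j == 0%N)%:R * u + (j == n)%:R * e + (n < j)%:R * (tau * (b (L - j)%N)^*).
pose row k := \sum_(0 <= j < k.+1) c j * b (k - j)%N.
have rowE k : row k = u * b k + (n <= k)%:R * (e * b (k - n)%N)
    + tau * \sum_(0 <= j < k.+1) (n < j)%:R * ((b (L - j)%N)^* * b (k - j)%N).
  rewrite /row mulr_sumr.
  rewrite -[u * b k]mul1r -[in RHS](subn0 k).
  rewrite -(sum_indicator k.+1 0 (fun j => u * b (k - j)%N)) subn0.
  rewrite -ltnS -(sum_indicator k.+1 n (fun j => e * b (k - j)%N)) -!big_split /=.
  by apply: eq_bigr => j _; rewrite /c; ring.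
have rowlt k : (k < n)%N -> row k = u * b k.
  move=> kn; rewrite rowE leqNgt kn mul0r addr0 big_nat big1
    ?mulr0 ?addr0 // => j /andP[_ jk].
  by rewrite ltnNge (leq_trans _ (ltnW kn)) ?mul0r // -ltnS.
have rown : row n = u * b n + e * b 0%N.
  rewrite rowE leqnn mul1r subnn big_nat big1 ?mulr0 ?addr0 // => j /andP[_ jk].
  by rewrite ltnNge -ltnS jk mul0r.
have SE : S = \sum_(0 <= j < L.+1) (n < j)%:R * cmod (b (L - j)%N) ^+ 2.
  rewrite SE0 [RHS](big_cat_nat _ (n := n.+1)) //=; last exact: ltnW.
  rewrite [X in _ = X + _]big_nat.
  rewrite [X in _ = X + _]big1 ?add0r => [|j /andP[_ jn]]; last first.
    by rewrite ltnNge -ltnS jn mul0r.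
  rewrite [RHS]big_nat_rev /= -{1}[n.+1]add0n big_addn subSS.
  apply: eq_big_nat => j /andP[_ jLn].
  rewrite (_ : (n < _)%N) ?mul1r; last by lia.
  by congr (cmod (b _) ^+ 2); lia.
(* The conjugates in the tail of [c] match the entries of row [L], so their products add up to
   [S]. *)
have rowL : row L = u * b L + e * b (L - n)%N + tau * S%:C.
  rewrite rowE (ltnW nL) mul1r SE rmorph_sum /=; congr (_ + tau * _).
  apply: eq_bigr => j _; rewrite mul_conjc.
  by case: (n < j)%N; rewrite ?mul1r // !mul0r.
have normc : \sum_(0 <= j < L.+1) cmod (c j) ^+ 2 =
    cmod u ^+ 2 + cmod e ^+ 2 + cmod tau ^+ 2 * S.
  rewrite SE mulr_sumr -[cmod u ^+ 2]mul1r -(sum_indicator L.+1 0 (fun=> cmod u ^+ 2)).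
  have -> : cmod e ^+ 2 = (n < L.+1)%:R * cmod e ^+ 2 by rewrite ltnS ltnW // mul1r.
  rewrite -(sum_indicator L.+1 n (fun=> cmod e ^+ 2)) -!big_split /=.
  apply: eq_bigr => j _; rewrite /c.
  have cm0 : cmod (0 : R[i]) = 0 by rewrite Normc.normc0.
  have conjm z : cmod (tau * z^*) ^+ 2 = cmod tau ^+ 2 * cmod z ^+ 2.
    rewrite Normc.normcM exprMn; congr (_ * _ ^+ 2).
    by apply: complexI; rewrite -!normcE_cmod norm_conjC.
  have [->|jn] := eqVneq j n.
    rewrite ltnn !mul0r !mulr0 !addr0 !mul1r.
    (* At [n = 0] the entries [u] and [e] would share position 0; in that case [e = 0]. *)
    case/orP: n_e => [n0|/eqP ->]; first by rewrite gtn_eqF // !mul0r !add0r.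
    by case: (n == 0)%N; rewrite ?mul1r ?mul0r ?addr0 ?cm0 ?expr0n ?addr0.
  have [->|j0] := eqVneq j 0%N; first by rewrite ltn0 !mul0r !mulr0 !addr0 !mul1r.
  by case: (n < j)%N; rewrite ?mul0r ?add0r ?mul1r ?conjm // cm0 expr0n mulr0.
rewrite -normc; apply: le_trans _ (contr c L.+1).
rewrite (big_nat_recr L) //= -/(row L) rowL lerD2r.
rewrite [leRHS](big_cat_nat _ (n := n.+1)) //= (big_nat_recr n) //= -/(row n) rown.
have -> : \sum_(0 <= k < n) cmod (u * b k) ^+ 2 = \sum_(0 <= k < n) cmod (row k) ^+ 2.
  by apply: eq_big_nat => k /andP[_ kn]; rewrite rowlt.
by rewrite lerDl sumr_ge0 // => k _; rewrite sqr_ge0.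
Qed.

(* [tau = X / d] is the optimal tail parameter in [toeplitz_test_vector]. *)
Lemma cmod_sqr_tail (R : realType) (X : R[i]) (S d : R) : 0 < d -> S = 1 - d ->
  cmod (X + X * (d^-1)%:C * S%:C) ^+ 2 = cmod (X * (d^-1)%:C) ^+ 2 * S + cmod X ^+ 2 / d.
Proof.
move=> d0 ->; case: X => x y; rewrite !cmod_sqr /=.
by field; rewrite gt_eqF.
Qed.

(** * Contractive two-by-two matrices *)

(** With [c = 1 - x], the product [(c - et^2) (c - al^2)] equals [(c - et al)^2 - c (et - al)^2].
    The last hypothesis thus reads [(et - al)^2 <= (c - et al)^2]; taking roots,
    [et (1 + al) <= 1 + al - x]. *)
Lemma contraction2_coef_ineq (R : realFieldType) (x al et : R) :
  0 <= x -> 0 <= al -> x + et ^+ 2 <= 1 -> x + al ^+ 2 <= 1 ->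
  x * (et - al) ^+ 2 <= (1 - x - et ^+ 2) * (1 - x - al ^+ 2) ->
  et <= 1 - x / (1 + al).
Proof.
move=> x0 al0 xe xa h.
have c0 : 0 <= 1 - et * al - x by have := sqr_ge0 (et - al); nra.
have h2 : (et - al) ^+ 2 <= (1 - et * al - x) ^+ 2 by nra.
have : et - al <= 1 - et * al - x.
  have [le0|gt0] := leP (et - al) 0; first by lra.
  by rewrite -(@ler_pXn2r _ 2) ?nnegrE // ltW.
move=> h3; have al1 : 0 < 1 + al by lra.
by rewrite lerBrDr -lerBrDl ler_pdivrMr //; lra.
Qed.

(** The quadratic [q B s^2 - 2 q s - C] is nonnegative for all [s]; for [B > 0] its minimum is at
    [s = 1 / B]. *)
Lemma discriminant_bound (R : realFieldType) (C B q : R) :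
  0 <= q -> 0 <= B -> (forall s, C + 2 * s * q <= s ^+ 2 * q * B) -> q <= - C * B.
Proof.
move=> q0 B0 h.
have C0 : C <= 0 by have := h 0; rewrite mulr0 mul0r expr0n /= !mul0r addr0.
move: q0; rewrite le_eqVlt => /predU1P[<-|q0]; first by rewrite mulr_ge0 // oppr_ge0.
move: B0; rewrite le_eqVlt => /predU1P[B0|B0].
  (* For [B = 0] the inequality is linear in [s]; this value turns it into [2 - C <= 0],
     contradicting [C <= 0]. *)
  have := h ((1 - C) / q); rewrite -B0 !mulr0 -mulrA divfK ?gt_eqF //; lra.
have := h B^-1; rewrite expr2 -!mulrA [B^-1 * (q * B)]mulrCA mulVf ?gt_eqF // mulr1 => h2.
have : q * B^-1 <= - C by lra.
by rewrite ler_pdivrMr.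
Qed.

(* The hypotheses say that the matrix [[g / sqrt d, a], [be / d, g / sqrt d]] is
   a contraction.  Testing [e = s * conj Q] for all real [s] is a discriminant
   condition on [|Q|^2]. *)
Lemma contraction2_bound (R : realType) (a g be : R[i]) (d : R) : 0 < d ->
  cmod a ^+ 2 + cmod g ^+ 2 / d <= 1 ->
  (forall e : R[i],
     cmod (g + e * a) ^+ 2 + cmod (be + e * g) ^+ 2 / d <= d + cmod e ^+ 2) ->
  cmod be <= d - cmod g ^+ 2 / (1 + cmod a).
Proof.
move=> d0 ha h.
(* Expanding the squares in [h] produces the cross term [2 Re (e Q)]. *)
pose Q : R[i] := a * g^*%C + g * be^*%C * (d^-1)%:C.
pose x := cmod g ^+ 2 / d; pose et := cmod be / d; pose al := cmod a.
have x0 : 0 <= x by rewrite divr_ge0 ?sqr_ge0 ?ltW.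
have et0 : 0 <= et by rewrite divr_ge0 ?cmod_ge0 ?ltW.
have al0 : 0 <= al := cmod_ge0 a.
have gx : cmod g ^+ 2 = x * d by rewrite /x divfK ?gt_eqF.
have bet : cmod be = et * d by rewrite /et divfK ?gt_eqF.
have hx : x + et ^+ 2 <= 1.
  have := h 0; rewrite !mul0r !addr0 Normc.normc0 expr0n addr0 gx bet.
  have -> : x * d + (et * d) ^+ 2 / d = (x + et ^+ 2) * d by field; rewrite gt_eqF.
  by rewrite -{2}[d]mul1r ler_pM2r.
have hQ : cmod Q ^+ 2 <= - (d * (x + et ^+ 2 - 1)) * (1 - x - al ^+ 2).
  apply: discriminant_bound; first by rewrite sqr_ge0.
    by rewrite /x /al; lra.
  move=> s; have := h (s%:C * Q^*%C).
  have -> : d * (x + et ^+ 2 - 1) = cmod g ^+ 2 + cmod be ^+ 2 / d - d.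
    by rewrite gx bet; field; rewrite gt_eqF.
  rewrite /x /al /Q; clear - d0; case: a g be => [a1 a2] [g1 g2] [b1 b2].
  rewrite !cmod_sqr /= => h; rewrite -subr_ge0; rewrite -subr_ge0 in h.
  apply: le_trans h _; rewrite le_eqVlt; apply/orP; left; apply/eqP.
  by field; rewrite gt_eqF.
(* Reverse triangle inequality for the two summands of [Q]. *)
have lQ : d * x * (et - al) ^+ 2 <= cmod Q ^+ 2.
  have key : - (2 * (cmod a * cmod g ^+ 2 * cmod be)) <=
      2 * complex.Re (a * g^*%C * (g * be^*%C)^*%C).
    have := normc_ge_Re (a * g^*%C * (g * be^*%C)^*%C).
    rewrite normcE_cmod lecR !Normc.normcM.
    have cJ z : cmod z^*%C = cmod z :> R by apply: complexI; rewrite -!normcE_cmod normcJ.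
    rewrite !cJ Normc.normcM cJ ler_norml => /andP[+ _]; lra.
  have : cmod Q ^+ 2 = cmod a ^+ 2 * cmod g ^+ 2 + cmod g ^+ 2 * cmod be ^+ 2 / d ^+ 2
     + 2 * complex.Re (a * g^*%C * (g * be^*%C)^*%C) / d.
    rewrite /Q; clear - d0; case: a g be => [a1 a2] [g1 g2] [b1 b2].
    by rewrite !cmod_sqr /=; field; rewrite gt_eqF.
  move=> ->; move: key; rewrite gx bet -/al; set rho := complex.Re _ => key.
  have : - (2 * (al * (x * d) * (et * d))) / d <= 2 * rho / d.
    by rewrite ler_pM2r ?invr_gt0.
  have -> : - (2 * (al * (x * d) * (et * d))) / d = - (2 * al * x * et * d).
    by field; rewrite gt_eqF.
  have -> : x * d * (et * d) ^+ 2 / d ^+ 2 = x * d * et ^+ 2 by field; rewrite gt_eqF.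
  nra.
have : et <= 1 - x / (1 + al).
  apply: contraction2_coef_ineq => //; first by rewrite addrC.
  rewrite -(ler_pM2l d0) mulrA; apply: le_trans lQ (le_trans hQ _).
  by rewrite le_eqVlt; apply/orP; left; apply/eqP; ring.
rewrite bet gx -(ler_pM2r d0) => /le_trans; apply.
by rewrite mulrBl mul1r mulrAC.
Qed.

(** * Carlson's inequalities *)

(** For [L = 2n + 1], [u = 1], [e = 0], the rows [0, ..., n] and the tail of the test vector yield
    the same sum [S]. The optimal [tau] then gives [|b_L|^2 / (1 - S) <= 1 - S]. *)
Lemma carlson_odd (R : realType) (b : nat -> R[i]) (n : nat) :
  toeplitz_contractive b ->
  cmod (b (2 * n).+1) <= 1 - \sum_(0 <= k < n.+1) cmod (b k) ^+ 2.
Proof.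
move=> contr; set S := \sum_(_ <= _ < _) _.
have nL : (n < (2 * n).+1)%N by lia.
have test tau : S + cmod (b (2 * n).+1 + tau * S%:C) ^+ 2 <= 1 + cmod tau ^+ 2 * S.
  have := @toeplitz_test_vector R b n (2 * n).+1 1 0 tau S contr nL.
  rewrite eqxx orbT => /(_ isT); rewrite (_ : ((2 * n).+1 - n)%N = n.+1); last by lia.
  move=> /(_ erefl).
  rewrite !mul1r !mul0r !addr0 Normc.normc1 Normc.normc0.
  rewrite expr1n expr0n addr0 /S (big_nat_recr n) //=.
  by under eq_bigr do rewrite mul1r.
have := test 0; rewrite mul0r addr0 Normc.normc0 expr0n mul0r addr0 => h0.
have be0 := cmod_ge0 (b (2 * n).+1); set be := cmod _ in h0 be0 *.
have : 0 <= 1 - S by have := sqr_ge0 be; lra.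
(* If [S = 1], the optimal [tau] is undefined, but [tau = 0] already forces [b_L = 0]. *)
rewrite le_eqVlt => /predU1P[d0|d0].
  have : be ^+ 2 <= 0 by lra.
  by rewrite -d0; nra.
have := test (b (2 * n).+1 * ((1 - S)^-1)%:C).
rewrite (cmod_sqr_tail _ d0); last by ring.
rewrite -/be => h.
have : be ^+ 2 / (1 - S) <= 1 - S by lra.
rewrite ler_pdivrMr // -expr2 ler_pXn2r ?nnegrE //; exact: ltW.
Qed.

(** For [L = 2n] the sum [S] stops before [n], and position [n] carries the free entry [e]. With the
    optimal [tau], the choices [(u, e) = (0, 1)] and [u = 1], [e] arbitrary, are the two hypotheses
    of [contraction2_bound] for [d = 1 - S]. *)
Lemma carlson_even (R : realType) (b : nat -> R[i]) (n : nat) :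
  toeplitz_contractive b -> (0 < n)%N ->
  cmod (b (2 * n)%N) <= 1 - \sum_(0 <= k < n) cmod (b k) ^+ 2
                        - cmod (b n) ^+ 2 / (1 + cmod (b 0%N)).
Proof.
move=> contr n0; set S := \sum_(_ <= _ < _) _.
have nL : (n < 2 * n)%N by lia.
have test u e tau : cmod u ^+ 2 * S + cmod (u * b n + e * b 0%N) ^+ 2
    + cmod (u * b (2 * n)%N + e * b n + tau * S%:C) ^+ 2
  <= cmod u ^+ 2 + cmod e ^+ 2 + cmod tau ^+ 2 * S.
  have := @toeplitz_test_vector R b n (2 * n)%N u e tau S contr nL.
  rewrite n0 => /(_ isT); rewrite (_ : (2 * n - n)%N = n); last by lia.
  move=> /(_ erefl); congr (_ + _ + _ <= _).
  rewrite mulr_sumr; apply: eq_bigr => k _.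
  by rewrite Normc.normcM exprMn.
have c0 := @Normc.normc0 R; have c1 := @Normc.normc1 R.
have := test 1 0 0; rewrite !mul0r !addr0 !mul1r c0 c1 expr1n expr0n
  mul0r !addr0 mul1r => h0.
have d0 : 0 <= 1 - S.
  by have := sqr_ge0 (cmod (b n)); have := sqr_ge0 (cmod (b (2 * n)%N)); lra.
move: d0; rewrite le_eqVlt => /predU1P[d0|d0].
  have g0 : cmod (b n) = 0 by have := sqr_ge0 (cmod (b (2 * n)%N)); nra.
  have b0 : cmod (b (2 * n)%N) = 0 by have := sqr_ge0 (cmod (b n)); nra.
  by rewrite g0 b0 expr0n mul0r -d0 subr0.
apply: contraction2_bound => //.
  have := test 0 1 (b n * ((1 - S)^-1)%:C).
  rewrite !mul0r !mul1r !add0r (cmod_sqr_tail _ d0); last by ring.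
  by rewrite c0 c1 expr1n expr0n mul0r !add0r; lra.
move=> e; have := test 1 e ((b (2 * n)%N + e * b n) * ((1 - S)^-1)%:C).
rewrite !mul1r (cmod_sqr_tail _ d0); last by ring.
by rewrite c1 expr1n mul1r; lra.
Qed.

(** * Rearrangement of the double series *)

(* [refined_coef be n] is the coefficient of [zeta_n] in the refined sum. *)
Definition refined_weight (R : realType) (al : R) (j n : nat) : R :=
  if n == (2 * j)%N then (1 + al)^-1 else (2 * j < n)%:R.

Definition refined_coef (R : realType) (be : nat -> R) (n : nat) : R :=
  be n + \sum_(1 <= j < n.+1) be j ^+ 2 * refined_weight (be 0%N) j n.

Lemma refined_weight_lt (R : realType) (al : R) (j n : nat) :
  (2 * j < n)%N -> refined_weight al j n = 1.
Proof. by move=> jn; rewrite /refined_weight gtn_eqF // jn. Qed.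

Lemma refined_weight_gt (R : realType) (al : R) (j n : nat) :
  (n < 2 * j)%N -> refined_weight al j n = 0.
Proof. by move=> nj; rewrite /refined_weight ltn_eqF // ltnNge ltnW. Qed.

Lemma refined_coef_odd (R : realType) (be : nat -> R) n :
  refined_coef be (2 * n).+1 = be (2 * n).+1 + \sum_(1 <= j < n.+1) be j ^+ 2.
Proof.
have nn : (n.+1 <= (2 * n).+2)%N by lia.
rewrite /refined_coef (big_cat_nat _ nn) //= [X in _ + (_ + X)]big_nat.
rewrite [X in _ + (_ + X)]big1 => [|j /andP[nj _]]; last first.
  have jn : ((2 * n).+1 < 2 * j)%N by lia.
  by rewrite refined_weight_gt ?mulr0.
rewrite addr0; congr (_ + _); apply: eq_big_nat => j /andP[_ jn].
have {}jn : (2 * j < (2 * n).+1)%N by lia.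
by rewrite refined_weight_lt ?mulr1.
Qed.

Lemma refined_coef_even (R : realType) (be : nat -> R) n : (0 < n)%N ->
  refined_coef be (2 * n)%N =
  be (2 * n)%N + \sum_(1 <= j < n) be j ^+ 2 + be n ^+ 2 / (1 + be 0%N).
Proof.
move=> n0; have nn : (n.+1 <= (2 * n).+1)%N by lia.
rewrite /refined_coef (big_cat_nat _ nn) //= [X in _ + (_ + X)]big_nat.
rewrite [X in _ + (_ + X)]big1 => [|j /andP[nj _]]; last first.
  have jn : (2 * n < 2 * j)%N by lia.
  by rewrite refined_weight_gt ?mulr0.
rewrite addr0 (big_nat_recr n) //= {2}/refined_weight eqxx addrA; congr (_ + _ + _).
apply: eq_big_nat => j /andP[_ jn].
have {}jn : (2 * j < 2 * n)%N by lia.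
by rewrite refined_weight_lt ?mulr1.
Qed.

Lemma eq_eseries_from (R : realFieldType) (f g : nat -> \bar R) N :
  (forall n, (N <= n)%N -> f n = g n) ->
  (\sum_(N <= n <oo) f n = \sum_(N <= n <oo) g n)%E.
Proof.
move=> fg; apply/congr_lim/funext => k; apply: eq_big_nat => n /andP[Nn _].
exact: fg.
Qed.

(** All terms are nonnegative, so Tonelli's theorem in the extended reals exchanges the two
    summations of [F]. *)
Lemma refined_series_rearrange (R : realType) (be z : nat -> R) :
  (forall n, 0 <= be n) -> (forall n, 0 <= z n) ->
  (\sum_(1 <= n <oo) (be n * z n)%:E
   + \sum_(1 <= n <oo) ((be n ^+ 2)%:E *
       ((z (2 * n)%N / (1 + be 0%N))%:E + \sum_((2 * n + 1)%N <= k <oo) (z k)%:E))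
   = \sum_(1 <= n <oo) (refined_coef be n * z n)%:E)%E.
Proof.
move=> be0 z0.
have w0 j n : 0 <= refined_weight (be 0%N) j n.
  by rewrite /refined_weight; case: ifP => _ //; rewrite invr_ge0 addr_ge0.
pose F j n : \bar R := (be j ^+ 2 * refined_weight (be 0%N) j n * z n)%:E.
have F0 j n : (0 <= F j n)%E by rewrite lee_fin !mulr_ge0 ?sqr_ge0.
have -> : (\sum_(1 <= j <oo) ((be j ^+ 2)%:E *
      ((z (2 * j)%N / (1 + be 0%N))%:E + \sum_((2 * j + 1)%N <= k <oo) (z k)%:E))
    = \sum_(1 <= j <oo) \sum_(1 <= n <oo) F j n)%E.
  apply: eq_eseries_from => j j1.
  (* In the finite part, [n <= 2 * j], only the term [n = 2 * j] survives; beyond it the weight is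
     1. *)
  rewrite (nneseries_split 1 (2 * j)) => [|k _]; last exact: F0.
  rewrite ge0_muleDr; last 2 first.
  - by rewrite lee_fin divr_ge0 // addr_ge0.
  - by apply: nneseries_ge0 => k _ _; rewrite lee_fin.
  rewrite [(1 + 2 * j)%N]addnC; congr (_ + _)%E.
    have j2 : (1 <= 2 * j)%N by lia.
    rewrite addn1 big_nat_recr //= big_nat big1 => [|k /andP[_ kj]].
      by rewrite add0e /F /refined_weight eqxx -EFinM mulrA mulrAC.
    by rewrite /F refined_weight_gt // mulr0 mul0r.
  rewrite -nneseriesZl => [|k _]; last by rewrite lee_fin.
  apply: eq_eseries_from => k jk.
  have {}jk : (2 * j < k)%N by rewrite -addn1.
  by rewrite /F refined_weight_lt // mulr1.
have -> : (\sum_(1 <= j <oo) \sum_(1 <= n <oo) F j n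
   = \sum_(1 <= n <oo) \sum_(1 <= j <oo) F j n)%E.
  rewrite eseries_cond [RHS]eseries_cond.
  under eq_eseriesr do rewrite eseries_cond.
  under [RHS]eq_eseriesr do rewrite eseries_cond.
  exact: nneseries_interchange.
rewrite -nneseriesD; last 2 first.
- by move=> n _ _; rewrite lee_fin mulr_ge0.
- by move=> n _ _; apply: nneseries_ge0 => j _ _; exact: F0.
apply: eq_eseries_from => n n1.
(* If [j > n] then [2 * j > n] and the weight is 0, so the inner series is a finite sum. *)
rewrite (nneseries_split 1 n) => [|k _]; last exact: F0.
rewrite [X in (_ + (_ + X))%E]eseries0 => [|j nj _]; last first.
  have {}nj : (n < 2 * j)%N by lia.
  by rewrite /F refined_weight_gt // mulr0 mul0r.
by rewrite adde0 sumEFin -EFinD /refined_coef mulrDl mulr_suml add1n.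
Qed.

(** * The extremal function *)

(** The identity [|1 - t w|^2 - |t - w|^2 = (1 - t^2) (1 - |w|^2)] gives both claims. *)
Lemma extremal_norm_lt1 (R : realType) (t : R) (w : R[i]) : 0 <= t < 1 -> cmod w < 1 ->
  1 - t%:C * w != 0 /\ cmod ((t%:C - w) / (1 - t%:C * w)) < 1.
Proof.
move=> /andP[t0 t1] w1.
have cw := cmod_ge0 w.
have sq : cmod (t%:C - w) ^+ 2 < cmod (1 - t%:C * w) ^+ 2.
  rewrite -subr_gt0.
  have -> : cmod (1 - t%:C * w) ^+ 2 - cmod (t%:C - w) ^+ 2 =
      (1 - t ^+ 2) * (1 - cmod w ^+ 2).
    by rewrite !cmod_sqr; case: w {w1 cw} => x y /=; ring.
  by rewrite mulr_gt0 // subr_gt0 expr_lt1.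
have d0 : 0 < cmod (1 - t%:C * w).
  rewrite lt_neqAle cmod_ge0 andbT eq_sym; apply: contraTneq sq => ->.
  by rewrite expr0n ltNge sqr_ge0.
split; first by apply: contraTneq d0 => ->; rewrite Normc.normc0 ltxx.
rewrite Normc.normcM Normc.normcV ltr_pdivrMr // mul1r.
by move: sq; rewrite ltr_pXn2r ?nnegrE ?cmod_ge0.
Qed.

Lemma extremal_classB (R : realType) (p m : nat) (t : R) :
  (0 < p)%N -> 0 <= t < 1 -> classB (extremal p m t).
Proof.
move=> p0 t01 z z1.
have cz : cmod z < 1 by rewrite -ltcR -normcE_cmod.
have wz : cmod (z ^+ p) < 1 by rewrite cmodX exprn_ilt1 ?cmod_ge0 // -lt0n.
have [d0 lt1] := extremal_norm_lt1 t01 wz.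
split; last first.
  rewrite normcE_cmod ltcR /extremal Normc.normcM cmodX.
  apply: le_lt_trans lt1; rewrite ler_piMl ?cmod_ge0 //.
  by rewrite exprn_ile1 ?cmod_ge0 // ltW.
have dX n : derivable (fun z : R[i]^o => z ^+ n : R[i]^o) z 1 by exact: exprn_derivable.
have dc (c : R[i]^o) : derivable (fun _ : R[i]^o => c) z 1 by exact: derivable_cst.
have num : derivable (fun z : R[i]^o => t%:C - z ^+ p : R[i]^o) z 1.
  by apply: derivableB; [exact: dc | exact: dX].
have den : derivable (fun z : R[i]^o => 1 - t%:C * z ^+ p : R[i]^o) z 1.
  by apply: derivableB; [exact: dc | apply: derivableM; [exact: dc | exact: dX]].
apply: derivableM; first exact: dX.
by apply: derivableM; [exact: num | exact: (derivableV d0 den)].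
Qed.

(** Taylor coefficients of [(t - w) / (1 - t w)] at 0. *)
Definition extremal_coef (R : realType) (t : R) (n : nat) : R :=
  if n is k.+1 then - ((1 - t ^+ 2) * t ^+ k) else t.

(** Keeping the exact remainder lets the induction close and reduces convergence to that of
    [(t w)^N] to 0. *)
Lemma extremal_coef_psum (R : realType) (t : R) (w : R[i]) N : 1 - t%:C * w != 0 ->
  \sum_(0 <= n < N.+1) (extremal_coef t n)%:C * w ^+ n =
  (t%:C - w) / (1 - t%:C * w) + (1 - t%:C ^+ 2) * w / (1 - t%:C * w) * (t%:C * w) ^+ N.
Proof.
move=> d0; elim: N => [|N IH].
  by rewrite big_nat1 expr0 /=; field.
rewrite (big_nat_recr N.+1) //= IH rmorphN rmorphM rmorphB rmorphXn rmorph1 /=.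
rewrite !exprMn !exprS rmorphXn /=.
by field.
Qed.

Lemma extremal_expansion (R : realType) (p m : nat) (t : R) :
  (0 < p)%N -> 0 <= t < 1 ->
  has_expansion p m (fun k => (extremal_coef t ((k - m) %/ p))%:C) (extremal p m t).
Proof.
move=> p0 t01 z z1.
have cz : cmod z < 1 by rewrite -ltcR -normcE_cmod.
have wz : cmod (z ^+ p) < 1 by rewrite cmodX exprn_ilt1 ?cmod_ge0 // -lt0n.
have [d0 _] := extremal_norm_lt1 t01 wz.
have /andP[t0 t1] := t01.
set w := z ^+ p in wz d0.
apply/cvg_cmodP => e e0.
pose C := cmod (z ^+ m * ((1 - t%:C ^+ 2) * w / (1 - t%:C * w))).
have C0 : 0 <= C := cmod_ge0 _.
have /cvgrPdist_lt : ((fun k => (t * cmod w) ^+ k) @ \oo --> (0 : R))%classic.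
  apply: cvg_expr; rewrite ger0_norm ?mulr_ge0 ?cmod_ge0 //.
  by rewrite mulr_ilt1 ?cmod_ge0.
(* [C] may be 0, hence the denominator [C + 1]. *)
have eC : 0 < e / (C + 1) by rewrite divr_gt0 // ltr_wpDl.
move=> /(_ _ eC)[N0 _ HN]; exists N0.+1 => [[//|N] NN].
have := HN N NN; rewrite /= sub0r normrN ger0_norm ?exprn_ge0 ?mulr_ge0 ?cmod_ge0 //.
rewrite ltr_pdivlMr ?ltr_wpDl // => h.
have -> : \sum_(0 <= n < N.+1)
      (extremal_coef t ((p * n + m - m) %/ p))%:C * z ^+ (p * n + m)
    = z ^+ m * \sum_(0 <= n < N.+1) (extremal_coef t n)%:C * w ^+ n.
  rewrite mulr_sumr; apply: eq_bigr => n _.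
  by rewrite addnK mulKn // exprD exprM; ring.
rewrite extremal_coef_psum // /extremal -/w mulrDr addrC addKr.
rewrite mulrA Normc.normcM -/C cmodX Normc.normcM cmod_real ger0_norm //.
apply: le_lt_trans h; rewrite mulrC ler_wpM2l ?exprn_ge0 ?mulr_ge0 ?cmod_ge0 //.
by rewrite lerDl.
Qed.

Lemma extremal_coef_sum_sqr (R : realType) (t : R) n :
  \sum_(1 <= j < n.+1) `|extremal_coef t j| ^+ 2 = (1 - t ^+ 2) * (1 - t ^+ (2 * n)).
Proof.
elim: n => [|n IH]; first by rewrite big_nil expr0 subrr mulr0.
rewrite (big_nat_recr n.+1) //= IH real_normK ?num_real // sqrrN exprMn.
by rewrite -exprM [(n * 2)%N]mulnC mulnS exprD; ring.
Qed.

(** In the even case [n = 2 (k + 1)], the term with denominator [1 + t] equals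
    [(1 - t^2) (t^(2k) - t^(2k+1))] and cancels the other powers of [t]. *)
Lemma refined_coef_extremal (R : realType) (t : R) n : 0 <= t < 1 -> (0 < n)%N ->
  refined_coef (fun k => `|extremal_coef t k|) n = 1 - t ^+ 2.
Proof.
move=> /andP[t0 t1] n0.
have nrm k : `|extremal_coef t k.+1| = (1 - t ^+ 2) * t ^+ k.
  by rewrite /= normrN ger0_norm // mulr_ge0 ?exprn_ge0 // subr_ge0 expr_le1 // ltW.
have [k [->|[k0 ->]]] : exists k, n = (2 * k).+1 \/ (0 < k)%N /\ n = (2 * k)%N.
  by exists (n./2); lia.
  by rewrite refined_coef_odd nrm extremal_coef_sum_sqr; ring.
case: k k0 => // k _; rewrite refined_coef_even // extremal_coef_sum_sqr.
rewrite (_ : (2 * k.+1)%N = (2 * k).+2); last by lia.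
rewrite !nrm exprMn -exprM [(k * 2)%N]mulnC (exprS t (2 * k)) /= ger0_norm //.
by field; lra.
Qed.

(** * Application to bounded functions, and conclusion *)

(** Any [p]-th root [z] of [w] will do: the partial sums at [w] are those of [f] at [z] divided by
    [z^m], and [|z|^-m <= |z|^-p = 1 / |w|] because [m <= p]. *)
Lemma expansion_bound (R : realType) (p m : nat)
    (f : R[i]^o -> R[i]^o) (a : nat -> R[i]^o) :
  (0 < p)%N -> (m <= p)%N -> classB f -> has_expansion p m a f ->
  power_series_le_inv (fun n => a (p * n + m)%N).
Proof.
move=> p0 mp fB fE w w0 w1.
pose z : R[i] := p.-root w.
have zp : z ^+ p = w by exact: rootCK.
have z0 : z != 0.
  by apply: contraNneq w0 => z0; rewrite -zp z0 expr0n gtn_eqF.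
have cw : cmod z ^+ p = cmod w by rewrite -cmodX zp.
have z1 : cmod z < 1 by rewrite -(expr_lt1 p0) ?cmod_ge0 // cw.
have cz0 : 0 < cmod z.
  rewrite lt_neqAle cmod_ge0 andbT eq_sym.
  by apply: contra z0 => /eqP /Normc.eq0_normc ->.
have Cz1 : `|z| < 1 by rewrite normcE_cmod ltcR.
have zm0 : 0 < cmod z ^+ m by rewrite exprn_gt0.
exists (f z / z ^+ m).
  rewrite Normc.normcM Normc.normcV cmodX.
  have [_] := fB z Cz1; rewrite normcE_cmod ltcR => f1.
  apply: (@le_trans _ _ (cmod z ^+ m)^-1).
    by rewrite ler_piMl ?invr_ge0 // ltW.
  by rewrite -cw lef_pV2 ?posrE ?exprn_gt0 // ler_wiXn2l // ltW.
apply/cvg_cmodP => e e0.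
have /cvg_cmodP/(_ _ (mulr_gt0 e0 zm0))[N HN] := fE z Cz1.
exists N => n /HN; rewrite -ltr_pdivrMr // -cmodX -Normc.normcV.
rewrite -Normc.normcM mulrBl mulr_suml; congr (cmod (_ - _) < e).
by apply: eq_bigr => k _; rewrite exprD exprM zp mulrA mulfK // expf_neq0.
Qed.

Lemma refined_coef_le (R : realType) (b : nat -> R[i]) n :
  toeplitz_contractive b ->
  (0 < n)%N -> refined_coef (fun k => cmod (b k)) n <= 1 - cmod (b 0%N) ^+ 2.
Proof.
move=> contr n0.
have [k [->|[k0 ->]]] : exists k, n = (2 * k).+1 \/ (0 < k)%N /\ n = (2 * k)%N.
  by exists (n./2); lia.
  have := carlson_odd k contr; rewrite refined_coef_odd big_ltn //.
  by set S := \sum_(_ <= _ < _) _; lra.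
have := carlson_even contr k0; rewrite refined_coef_even // big_ltn //.
by set S := \sum_(_ <= _ < _) _; lra.
Qed.

Lemma refined_bohr_sumE (R : realType) (zeta : nat -> R -> R) (p m : nat)
    (a : nat -> R[i]^o) (r : R) : (forall n, 0 <= zeta n (r ^+ p)) ->
  refined_bohr_sum zeta p m a r =
  (\sum_(1 <= n <oo)
     (refined_coef (fun k => cmod (a (p * k + m)%N)) n * zeta n (r ^+ p))%:E)%E.
Proof.
move=> z0; rewrite -(refined_series_rearrange (fun n => cmod_ge0 _) z0) /refined_bohr_sum.
rewrite muln0 add0n.
by congr (_ + _)%E; apply: eq_eseries_from => n _; rewrite [(n * p)%N]mulnC.
Qed.

Lemma bohr_boundE (R : realType) (zeta : nat -> R -> R) (p m : nat)
    (a : nat -> R[i]^o) (r : R) : (forall n, 0 <= zeta n (r ^+ p)) ->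
  bohr_bound zeta p m a r =
  (\sum_(1 <= n <oo) ((1 - cmod (a m) ^+ 2) * zeta n (r ^+ p))%:E)%E.
Proof.
move=> z0; rewrite /bohr_bound -nneseriesZl // => n _.
by rewrite lee_fin.
Qed.

Theorem corollary4 (R : realType) (zeta : nat -> R -> R) (p m : nat)
    (hzeta : classF zeta) (hp : (1 <= p)%N) (hm : (m <= p)%N) :
  (forall (f : R[i]^o -> R[i]^o) (a : nat -> R[i]^o),
     classB f -> has_expansion p m a f ->
     forall r : R, 0 <= r < 1 ->
       (refined_bohr_sum zeta p m a r <= bohr_bound zeta p m a r)%E)
  /\
  (forall t : R, 0 <= t < 1 ->
     classB (extremal p m t) /\
     exists2 a : nat -> R[i]^o, has_expansion p m a (extremal p m t) &
       forall r : R, 0 <= r < 1 ->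
         refined_bohr_sum zeta p m a r = bohr_bound zeta p m a r).
Proof.
have zeta_ge0 r n : 0 <= r < 1 -> 0 <= zeta n (r ^+ p).
  move=> /andP[r0 r1]; case: hzeta => z0 _ _; apply: z0.
  by rewrite exprn_ge0 //= exprn_ilt1 // -lt0n.
split=> [f a fB fE r r01|t t01].
  have z0 n := zeta_ge0 r n r01.
  (* Both sides become single series in [zeta_n]; [eseries_cond] turns the lower index into a
     condition, so coefficients are compared for [n >= 1] only. *)
  rewrite refined_bohr_sumE // bohr_boundE // eseries_cond [leRHS]eseries_cond.
  have contr := toeplitz_contraction (expansion_bound hp hm fB fE).
  apply: lee_nneseries => [n _ _|n /andP[_ n0]].
    rewrite lee_fin mulr_ge0 // addr_ge0 ?cmod_ge0 // sumr_ge0 // => j _.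
    rewrite mulr_ge0 ?sqr_ge0 // /refined_weight; case: ifP => _ //.
    by rewrite invr_ge0 addr_ge0 ?cmod_ge0.
  rewrite lee_fin ler_wpM2r //.
  by have := refined_coef_le contr n0; rewrite muln0 add0n.
split; first exact: extremal_classB.
(* [(k - m) %/ p] recovers [n] from [k = p * n + m]. *)
exists (fun k => (extremal_coef t ((k - m) %/ p))%:C); first exact: extremal_expansion.
move=> r r01; have z0 n := zeta_ge0 r n r01.
rewrite refined_bohr_sumE // bohr_boundE //; apply: eq_eseries_from => n n0.
have t0 : `|extremal_coef t 0| = t by rewrite /= ger0_norm //; case/andP: t01.
rewrite subnn div0n cmod_real t0 -(refined_coef_extremal t01 n0).
congr (refined_coef _ _ * _)%:E; apply/funext => k.
by rewrite addnK mulKn // cmod_real.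
Qed.
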